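(* Let $\epsilon\in(0,\frac12)$ be fixed and let $(C_N)$ be a family of linear codes $C_N\subseteq\mathbb{F}_2^N$ (indexed by an infinite set of lengths $N$). Let $A_\epsilon=A_{\epsilon}(N):=\{\alpha N\in\mathbb{N}: \alpha\in[0,1],\ h(\alpha)>1-h(\epsilon)-N^{-1/5}\}$. Suppose that for every $j\in A_\epsilon$, $$\Pr_{y\sim\mathcal{D}(C_N^\perp)}\big[\mathrm{wt}(y)=j\big]\leq\big(1+o(N^{-1})\big)\frac{\binom{N}{j}}{2^N},$$ where the $o(N^{-1})$ is as $N\to\infty$, uniformly in $j\in A_\epsilon$, and suppose that $$\Pr_{y\sim\mathcal{D}(C_N^\perp)}\big[\mathrm{wt}(y)\notin A_\epsilon\big]\leq 2^{N^{3/4}}\cdot\frac{\sum_{i\in\{0,\dots,N\}\setminus A_\epsilon}\binom{N}{i}}{2^N}.$$ Then $(C_N)$ is resilient to $\epsilon$-errors: there exist decoding functions $d_N:\mathbb{F}_2^N\to C_N$ such that for every sequence of codewords $c_N\in C_N$, $\lim_{N\to\infty}\Pr_{\rho\sim P_\epsilon}[d_N(c_N+\rho)\neq c_N]=0$.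
   Context: $h(\alpha)=\alpha\log_2\frac1\alpha+(1-\alpha)\log_2\frac1{1-\alpha}$ is the binary entropy function (with $h(0)=h(1)=0$). $\mathbb{N}=\{0,1,2,\dots\}$. $\mathrm{wt}$ is Hamming weight. $P_\epsilon$ is the distribution on $\mathbb{F}_2^N$ given by $P_\epsilon(z)=\epsilon^{\mathrm{wt}(z)}(1-\epsilon)^{N-\mathrm{wt}(z)}$. $C^\perp$ is the orthogonal complement (dual code) of $C$ in $\mathbb{F}_2^N$, and $\mathcal{D}(X)$ is the uniform distribution on a finite set $X$. *)

(* Defs.v *)
From mathcomp Require Import all_boot all_order all_algebra.
From mathcomp Require Import all_classical all_reals all_analysis.

Set Implicit Arguments.
Unset Strict Implicit.
Unset Printing Implicit Defensive.

Import Order.TTheory GRing.Theory Num.Theory.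
Import numFieldNormedType.Exports.

Local Open Scope classical_set_scope.
Local Open Scope ring_scope.

Definition log2 (R : realType) (x : R) : R := ln x / ln 2.

(* Since [0 * _ = 0], this gives h(0) = h(1) = 0 as usual. *)
Definition entropy (R : realType) (a : R) : R :=
  a * log2 (1 / a) + (1 - a) * log2 (1 / (1 - a)).

Definition wt (N : nat) (z : 'rV['F_2]_N) : nat :=
  #|[set i : 'I_N | z 0 i != 0]%SET|.

Definition dual (N : nat) (C : {vspace 'rV['F_2]_N}) : {set 'rV['F_2]_N} :=
  [set y : 'rV['F_2]_N |
    [forall x : 'rV['F_2]_N, (x \in C) ==> (\sum_(i < N) x 0 i * y 0 i == 0)]]%SET.

Definition uniform (R : realType) (T : finType) (X : {set T}) (y : T) : R :=
  if y \in X then #|X|%:R^-1 else 0.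

Definition noise (R : realType) (eps : R) (N : nat) (z : 'rV['F_2]_N) : R :=
  eps ^+ wt z * (1 - eps) ^+ (N - wt z).

Definition Pr (R : realType) (T : finType) (P : T -> R) (E : pred T) : R :=
  \sum_(z : T | E z) P z.

Definition typical_weights (R : realType) (eps : R) (N : nat) : set nat :=
  [set j | exists a : R,
    [/\ 0 <= a <= 1, a * N%:R = j%:R
      & entropy a > 1 - entropy eps - N%:R `^ (- (1 / 5))]].

(* A family of codes indexed by a set [S] of lengths is a total function [C]
   of which only the values at lengths in [S] are ever constrained or used;
   limits are taken as N tends to infinity inside [S]. *)
Definition resilient (R : realType) (eps : R) (S : set nat)
    (C : forall N : nat, {vspace 'rV['F_2]_N}) : Prop :=
  exists d : forall N : nat, 'rV['F_2]_N -> 'rV['F_2]_N,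
    (forall N : nat, S N -> forall x : 'rV['F_2]_N, d N x \in C N) /\
    (forall c : forall N : nat, 'rV['F_2]_N,
       (forall N : nat, S N -> c N \in C N) ->
       Pr (@noise R eps N) (fun rho => d N (c N + rho) != c N)
         @[N --> within S \oo] --> (0 : R)).

(* Main.v *)
(* Decode to the nearest codeword. It fails on the noise [r] only if [r + z] is
   in the code for some [z != r] with [wt z <= wt r] ("[r] collides"). By Poisson
   summation, the number of pairs (r, z) in the Hamming ball of radius w with
   [r + z] in the code is the average over the dual code of the squared Fourier
   transform of the ball, which is a function of the weight of the dual word.
   On typical weights this average is at most (1 + delta) times the average over
   the whole cube, which by Plancherel is |ball|, i.e. the contribution of the
   diagonal r = z; on atypical weights the transform is bounded by |ball|, and the
   entropy gap N^(4/5) beats 2^(N^(3/4)) as long as w <= eps N + N^(2/3). Since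
   |ball| <= (N + 1) 'C(N, w) for w <= N / 2, the fraction of colliding words of
   weight w is at most (N + 1)(|delta| + o(1/N)), which tends to 0 because
   delta = o(1/N). Larger noise weights are excluded by a Chernoff bound. *)

Require Import Defs.
From mathcomp Require Import all_boot all_order all_algebra.
From mathcomp Require Import all_classical all_reals all_analysis.
From mathcomp Require Import ring lra zify.

Set Implicit Arguments.
Unset Strict Implicit.
Unset Printing Implicit Defensive.

Import Order.TTheory GRing.Theory Num.Theory.
Import numFieldNormedType.Exports.

Local Open Scope classical_set_scope.
Local Open Scope ring_scope.

(** * Characters of the binary cube, dual codes and Poisson summation *)

Definition dot (N : nat) (x y : 'rV['F_2]_N) : 'F_2 := \sum_(i < N) x 0 i * y 0 i.

(** The nontrivial additive character of ['F_2]. *)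
Definition chi (R : realType) (a : 'F_2) : R := (-1) ^+ (a != 0).

Definition ball (N w : nat) : {set 'rV['F_2]_N} := [set z | (wt z <= w)%N]%SET.

(** The unnormalised Fourier transform of the indicator of [ball N w]. *)
Definition ball_hat (R : realType) (N w : nat) (y : 'rV['F_2]_N) : R :=
  \sum_(z : 'rV['F_2]_N | (wt z <= w)%N) chi R (dot z y).

Lemma F2_cases (P : 'F_2 -> Prop) : P 0 -> P 1 -> forall a, P a.
Proof.
move=> P0 P1 [[|[|//]] i].
  by have -> : Ordinal i = 0 :> 'F_2 by exact: val_inj.
by have -> : Ordinal i = 1 :> 'F_2 by exact: val_inj.
Qed.

Lemma chiD (R : realType) (a b : 'F_2) : chi R (a + b) = chi R a * chi R b.
Proof.
rewrite /chi.
by elim/F2_cases: a; elim/F2_cases: b; rewrite /= ?expr0 ?expr1 ?mulr1 ?mul1r // mulrNN mulr1.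
Qed.

Lemma chi0 (R : realType) : chi R 0 = 1. Proof. by rewrite /chi eqxx. Qed.

Lemma chi_neq0 (R : realType) (a : 'F_2) : a != 0 -> chi R a = -1.
Proof. by rewrite /chi => ->. Qed.

Lemma normr_chi (R : realType) (a : 'F_2) : `|chi R a| = 1.
Proof. by rewrite /chi normrX normrN1 expr1n. Qed.

Lemma chi_sum (R : realType) (I : finType) (F : I -> 'F_2) :
  chi R (\sum_i F i) = \prod_i chi R (F i).
Proof. exact: (big_morph _ (@chiD R) (chi0 R)). Qed.

Lemma dotC (N : nat) (x y : 'rV['F_2]_N) : dot x y = dot y x.
Proof. by apply: eq_bigr => i _; rewrite mulrC. Qed.

Lemma dotDl (N : nat) (x x' y : 'rV['F_2]_N) : dot (x + x') y = dot x y + dot x' y.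
Proof. by rewrite /dot -big_split; apply: eq_bigr => i _; rewrite mxE mulrDl. Qed.

Lemma addrr_F2row (N : nat) (x : 'rV['F_2]_N) : x + x = 0.
Proof. by apply/rowP => i; rewrite !mxE; elim/F2_cases: (x 0 i); rewrite ?addr0 //; exact: val_inj. Qed.

Lemma mem_dual (N : nat) (C : {vspace 'rV['F_2]_N}) (y : 'rV['F_2]_N) :
  reflect (forall x, x \in C -> dot x y = 0) (y \in dual C).
Proof.
rewrite inE; apply: (iffP forallP) => [h x xC|h x].
  by have /implyP /(_ xC) /eqP := h x.
by apply/implyP => xC; rewrite -/(dot x y) h.
Qed.

(** The code is the row space of the matrix [A] listing all its words. A vector outside that row
    space is not killed by the cokernel of [A], and a column of the cokernel with nonzero product
    serves as [y]. *)
Lemma double_dual (N : nat) (C : {vspace 'rV['F_2]_N}) (x : 'rV['F_2]_N) :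
  x \notin C -> exists2 y, y \in dual C & dot x y != 0.
Proof.
move=> xC.
pose A := \matrix_(i < #|[set c in C]%SET|) (enum_val i : 'rV['F_2]_N).
have dotE (u : 'rV['F_2]_N) j : dot u (row j (cokermx A)^T) = (u *m cokermx A) 0 j.
  by rewrite mxE; apply: eq_bigr => i _; rewrite !mxE.
have : ~~ (x <= A)%MS.
  apply: contra xC => /submxP[D ->]; rewrite mulmx_sum_row.
  apply: memv_suml => i _; apply: memvZ; rewrite rowK.
  by have := enum_valP i; rewrite inE.
rewrite submxE => /eqP/rowP/existsNP[j /eqP]; rewrite [X in _ != X]mxE => jP.
exists (row j (cokermx A)^T); last by rewrite dotE.
apply/mem_dual => c cC; rewrite dotE.
have cI : c \in [set c in C]%SET by rewrite inE.
have : (c <= A)%MS.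
  have -> : c = row (enum_rank_in cI c) A by rewrite rowK enum_rankK_in.
  exact: row_sub.
by rewrite submxE => /eqP ->; rewrite mxE.
Qed.

Lemma dual_gt0 (N : nat) (C : {vspace 'rV['F_2]_N}) : (0 < #|dual C|)%N.
Proof.
apply/card_gt0P; exists 0; apply/mem_dual => x _.
by rewrite /dot big1 // => i _; rewrite mxE mulr0.
Qed.

Lemma dualD (N : nat) (C : {vspace 'rV['F_2]_N}) (y y' : 'rV['F_2]_N) :
  y \in dual C -> y' \in dual C -> y + y' \in dual C.
Proof.
move=> /mem_dual h /mem_dual h'; apply/mem_dual => x xC.
by rewrite dotC dotDl ![dot _ x]dotC h ?h' ?addr0.
Qed.

(** If [x] is outside the code, some dual word [y0] has [chi R (dot x y0) = -1]. Translation by [y0]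
    permutes the dual code and flips the sign of the sum, which is therefore zero. *)
Lemma chi_sum_dual (R : realType) (N : nat) (C : {vspace 'rV['F_2]_N}) (x : 'rV['F_2]_N) :
  \sum_(y in dual C) chi R (dot x y) = #|dual C|%:R * (x \in C)%:R.
Proof.
have [xC|xC] := boolP (x \in C).
  rewrite mulr1 -sum1_card natr_sum; apply: eq_bigr => y /mem_dual yC.
  by rewrite yC // chi0.
have [y0 y0C xy0] := double_dual xC.
rewrite mulr0; set s := \sum_(_ in _) _.
suff sN : s = - s by clearbody s; lra.
rewrite {1}/s (reindex_inj (addIr y0)) -sumrN; apply: eq_big => [y|y _].
  apply/idP/idP => [h|h]; last exact: dualD.
  by rewrite -[y]addr0 -(addrr_F2row y0) addrA dualD.
by rewrite [dot x _]dotC dotDl ![dot _ x]dotC chiD (chi_neq0 R xy0) mulrN1.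
Qed.

(* Poisson summation over the dual code, for the indicator of a Hamming ball. *)
Lemma ball_pairs_dual (R : realType) (N : nat) (C : {vspace 'rV['F_2]_N}) (w : nat) :
  \sum_(y in dual C) ball_hat R w y ^+ 2 =
  #|dual C|%:R * \sum_(r : 'rV['F_2]_N | (wt r <= w)%N)
    \sum_(z : 'rV['F_2]_N | (wt z <= w)%N) (r + z \in C)%:R.
Proof.
rewrite mulr_sumr.
under [RHS]eq_bigr => r _.
  rewrite mulr_sumr.
  under eq_bigr => z _ do rewrite -chi_sum_dual.
  rewrite exchange_big; over.
rewrite exchange_big; apply: eq_bigr => y _.
rewrite expr2 /ball_hat mulr_suml; apply: eq_bigr => r _.
by rewrite mulr_sumr; apply: eq_bigr => z _; rewrite dotDl chiD.
Qed.

(** Poisson summation for the zero code: its dual is the whole space, and [r + z = 0] only on the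
    diagonal [z = r]. *)
Lemma ball_hat_plancherel (R : realType) (N w : nat) :
  \sum_(y : 'rV['F_2]_N) ball_hat R w y ^+ 2 =
  2 ^+ N * #|ball N w|%:R.
Proof.
have dual0 : dual (0%VS : {vspace 'rV['F_2]_N}) = [set: 'rV['F_2]_N]%SET.
  apply/setP => y; rewrite finset.in_setT; apply/mem_dual => x; rewrite memv0 => /eqP ->.
  by rewrite /dot big1 // => i _; rewrite mxE mul0r.
have := ball_pairs_dual R (0%VS : {vspace 'rV['F_2]_N}) w.
rewrite dual0 cardsT card_mx card_Fp // mul1n natrX.
under eq_bigl do rewrite finset.in_setT.
move=> ->; congr (_ * _); rewrite -sum1_card natr_sum.
under [RHS]eq_bigl do rewrite inE.
apply: eq_bigr => r rw; rewrite (bigD1 r) //= addrr_F2row memv0 eqxx big1 ?addr0 // => z /andP[_ zr].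
by rewrite memv0 addr_eq0 -(addr0 (- z)) -(addrr_F2row z) addKr eq_sym (negPf zr).
Qed.

(** * Weight enumerators; the transform of a ball depends only on the weight *)

Lemma sum_prod_row (A : comNzRingType) (N : nat) (F : 'I_N -> 'F_2 -> A) :
  \sum_(z : 'rV['F_2]_N) \prod_i F i (z 0 i) = \prod_i (F i 0 + F i 1).
Proof.
have -> : \prod_i (F i 0 + F i 1) = \prod_i \sum_(a : 'F_2) F i a.
  by apply: eq_bigr => i _; rewrite 2!big_ord_recl big_ord0 addr0; congr (F _ _ + F _ _); apply: val_inj.
rewrite bigA_distr_bigA.
rewrite (reindex (fun f : {ffun 'I_N -> 'F_2} => \row_i f i)); last first.
  exists (fun z : 'rV['F_2]_N => [ffun i => z 0 i]) => [f _|z _].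
    by apply/ffunP => i; rewrite ffunE mxE.
  by apply/rowP => i; rewrite mxE ffunE.
by apply: eq_bigr => f _; apply: eq_bigr => i _; rewrite mxE.
Qed.

Lemma prod_wt (A : comNzRingType) (N : nat) (y : 'rV['F_2]_N) (a b : A) :
  \prod_i (if y 0 i != 0 then a else b) = a ^+ wt y * b ^+ (N - wt y).
Proof.
rewrite (bigID (fun i => y 0 i != 0)) /=; congr (_ * _).
  rewrite (eq_bigr (fun=> a)) => [|i ->//].
  by rewrite prodr_const /wt cardsE.
rewrite (eq_bigr (fun=> b)) => [|i /negPf ->//].
rewrite prodr_const; congr (_ ^+ _).
set s := [set i | y 0 i != 0]%SET.
rewrite /wt -/s -[X in (X - _)%N](card_ord N) -(cardsC s) addKn.
by apply: eq_card => i; rewrite !inE.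
Qed.

Lemma wt_le (N : nat) (y : 'rV['F_2]_N) : (wt y <= N)%N.
Proof. by rewrite -[X in (_ <= X)%N](card_ord N) max_card. Qed.

Lemma wt_enumerator (A : comNzRingType) (N : nat) (a b : A) :
  \sum_(z : 'rV['F_2]_N) a ^+ wt z * b ^+ (N - wt z) = (a + b) ^+ N.
Proof.
under eq_bigr do rewrite -prod_wt.
rewrite (sum_prod_row (fun=> (fun c : 'F_2 => if c != 0 then a else b))) /=.
by rewrite prodr_const card_ord addrC.
Qed.

(** Both sides are the coefficient of [X^k] in [(X + 1)^N]. *)
Lemma card_wt (N k : nat) : #|[set z : 'rV['F_2]_N | wt z == k]%SET| = 'C(N, k).
Proof.
have := wt_enumerator N 'X (1 : {poly int}).
move=> /(congr1 (fun p : {poly int} => p`_k)).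
rewrite addrC exprDn !coef_sum.
under eq_bigr do rewrite expr1n mulr1 coefXn.
under [RHS]eq_bigr do rewrite expr1n mul1r coefMn coefXn.
have -> : \sum_(i < N.+1) (k == i)%:R *+ 'C(N, i) = 'C(N, k)%:R :> int.
  have [kN|kN] := leqP k N.
    rewrite (bigD1 (Ordinal (kN : (k < N.+1)%N))) //= eqxx big1 ?addr0 // => i.
    by rewrite -val_eqE /= eq_sym => /negPf ->; rewrite mul0rn.
  rewrite bin_small // big1 // => i _.
  by rewrite gtn_eqF ?mul0rn // (leq_ltn_trans _ kN) // -ltnS.
move=> h.
have : #|[set z : 'rV['F_2]_N | wt z == k]%SET|%:R = 'C(N, k)%:R :> int.
  rewrite -h -sum1_card natr_sum big_mkcond /=.
  by apply: eq_bigr => z _; rewrite inE eq_sym; case: eqP.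
by move/eqP; rewrite eqr_nat => /eqP.
Qed.

Lemma ball_hat_wt (R : realType) (N w : nat) (y y' : 'rV['F_2]_N) :
  wt y = wt y' -> ball_hat R w y = ball_hat R w y'.
Proof.
(* The transform of the sphere of radius [k] at [y] is the coefficient of
   [X^k] in [(1 - X)^(wt y) (1 + X)^(N - wt y)]. *)
have gen (u : 'rV['F_2]_N) : \sum_(z : 'rV['F_2]_N) (chi R (dot z u))%:P * 'X^(wt z) =
    (1 - 'X) ^+ wt u * (1 + 'X) ^+ (N - wt u) :> {poly R}.
  rewrite -prod_wt.
  transitivity (\sum_(z : 'rV['F_2]_N) \prod_i ((chi R (z 0 i * u 0 i))%:P *
      (if z 0 i != 0 then 'X else 1))).
    apply: eq_bigr => z _; rewrite big_split /= prod_wt expr1n mulr1 chi_sum.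
    by rewrite rmorph_prod.
  rewrite (sum_prod_row (fun i (c : 'F_2) => (chi R (c * u 0 i))%:P * (if c != 0 then 'X else 1))).
  apply: eq_bigr => i _; rewrite eqxx /= mul0r mul1r chi0 mulr1 /chi.
  by case: ifP; rewrite ?expr1 ?expr0 ?polyCN ?polyC1 ?mulN1r ?mul1r.
have hatE (u : 'rV['F_2]_N) : ball_hat R w u =
    \sum_(k < w.+1) ((1 - 'X) ^+ wt u * (1 + 'X) ^+ (N - wt u))`_k.
  under eq_bigr do rewrite -gen coef_sum.
  rewrite exchange_big /ball_hat big_mkcond; apply: eq_bigr => z _.
  under eq_bigr do rewrite coefCM coefXn.
  rewrite -mulr_sumr; case: ifPn => [zw|].
    rewrite (bigD1 (Ordinal (zw : (wt z < w.+1)%N))) //= eqxx big1 ?addr0 ?mulr1 // => i.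
    by rewrite -val_eqE => /negPf /= ->.
  rewrite -ltnNge => zw; rewrite big1 ?mulr0 // => i _.
  by rewrite ltn_eqF // (leq_ltn_trans _ zw) // -ltnS.
by move=> e; rewrite !hatE e.
Qed.

(** * Counting pairs in a ball through the weight distribution of the dual code *)

Lemma sum_by_wt (R : realType) (N : nat) (P : pred 'rV['F_2]_N) (F : 'rV['F_2]_N -> R) :
  \sum_(z | P z) F z = \sum_(w < N.+1) \sum_(z | P z && (wt z == w)) F z.
Proof.
rewrite (partition_big (fun z : 'rV['F_2]_N => inord (wt z) : 'I_N.+1) xpredT) //=.
apply: eq_bigr => w _; apply: eq_bigl => z.
by rewrite -val_eqE /= inordK // ltnS wt_le.
Qed.

Lemma dual_average (R : realType) (N : nat) (C : {vspace 'rV['F_2]_N}) (F : 'rV['F_2]_N -> R) :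
  #|dual C|%:R^-1 * \sum_(y in dual C) F y = \sum_y uniform R (dual C) y * F y.
Proof.
rewrite big_mkcond mulr_sumr; apply: eq_bigr => y _.
by rewrite /uniform; case: ifP; rewrite ?mulr0 ?mul0r.
Qed.

Lemma uniform_ge0 (R : realType) (T : finType) (X : {set T}) (y : T) : 0 <= uniform R X y.
Proof. by rewrite /uniform; case: ifP. Qed.

Lemma ball_hat_le (R : realType) (N w : nat) (y : 'rV['F_2]_N) :
  ball_hat R w y ^+ 2 <= #|ball N w|%:R ^+ 2.
Proof.
rewrite -real_normK ?num_real // lerXn2r ?nnegrE //.
apply: (le_trans (ler_norm_sum _ _ _)); rewrite -sum1_card natr_sum.
rewrite [X in _ <= X](eq_bigl (fun z : 'rV_N => (wt z <= w)%N)) => [|z]; last by rewrite inE.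
by apply: ler_sum => z _; rewrite normr_chi.
Qed.

(** By Poisson summation the count is the mean of the squared transform over the dual code. Weights
    outside [T] get the pointwise bound [ball_hat_le]; on the others the transform is constant on
    each weight class, so the hypothesis applies class by class. The absolute value of [delta] keeps
    the factor nonnegative when the sum over [T] is enlarged to the whole space. *)
Lemma ball_pairs_le (R : realType) (N : nat) (C : {vspace 'rV['F_2]_N}) (w : nat)
    (T : set nat) (delta zeta : R) :
  (forall j, j \in T ->
     Pr (uniform R (dual C)) (fun y => wt y == j) <= (1 + delta) * ('C(N, j)%:R / 2 ^+ N)) ->
  Pr (uniform R (dual C)) (fun y => wt y \notin T) <= zeta ->
  \sum_(r : 'rV['F_2]_N | (wt r <= w)%N)
    \sum_(z : 'rV['F_2]_N | (wt z <= w)%N) (r + z \in C)%:R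
  <= (1 + `|delta|) * #|ball N w|%:R + #|ball N w|%:R ^+ 2 * zeta.
Proof.
move=> htyp hatyp; set b : R := #|ball N w|%:R.
have d0 : #|dual C|%:R != 0 :> R by rewrite pnatr_eq0 -lt0n dual_gt0.
rewrite -[X in X <= _](mulKf d0) -ball_pairs_dual dual_average.
rewrite (bigID (fun y : 'rV_N => wt y \in T)) /=; apply: lerD; last first.
  apply: le_trans (_ : b ^+ 2 * Pr (uniform R (dual C)) (fun y => wt y \notin T) <= _).
    rewrite /Pr mulr_sumr; apply: ler_sum => y _.
    by rewrite mulrC ler_wpM2r ?uniform_ge0 // ball_hat_le.
  by rewrite ler_wpM2l // sqr_ge0.
(* By Plancherel, the ball size is the mean of the squared transform over the whole space. *)
have -> : b = (2 ^+ N)^-1 * \sum_(y : 'rV['F_2]_N) ball_hat R w y ^+ 2.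
  by rewrite ball_hat_plancherel mulKf // expf_neq0.
apply: le_trans (_ : (1 + `|delta|) * ((2 ^+ N)^-1 *
    \sum_(y : 'rV['F_2]_N | wt y \in T) ball_hat R w y ^+ 2) <= _); last first.
  rewrite ler_wpM2l ?addr_ge0 // ler_wpM2l ?invr_ge0 ?exprn_ge0 //.
  by rewrite [X in _ <= X](bigID (fun y : 'rV_N => wt y \in T)) /= lerDl sumr_ge0 // => y _; rewrite sqr_ge0.
rewrite mulrA mulr_sumr !sum_by_wt; apply: ler_sum => j _.
(* Either the class of weight [j] lies wholly in the sum, with [y0] as representative, or both sides
   are empty. *)
have [[y0 /andP[y0T /eqP y0j]]|no] := pselect (exists y : 'rV['F_2]_N, (wt y \in T) && (wt y == j)); last first.
  by rewrite !big1 // => y yP; case: no; exists y.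
rewrite (eq_bigl (fun y : 'rV_N => wt y == j)); last first.
  by move=> y /=; case: eqP => [->|]; rewrite ?andbT ?andbF // -y0j y0T.
rewrite [X in _ <= X](eq_bigl (fun y : 'rV_N => wt y == j)); last first.
  by move=> y /=; case: eqP => [->|]; rewrite ?andbT ?andbF // -y0j y0T.
have hatE (y : 'rV_N) : wt y == j -> ball_hat R w y = ball_hat R w y0.
  by move=> /eqP yj; apply: ball_hat_wt; rewrite y0j.
have cst (a : 'rV['F_2]_N -> R) : \sum_(y | wt y == j) a y * ball_hat R w y ^+ 2 =
    (\sum_(y | wt y == j) a y) * ball_hat R w y0 ^+ 2.
  by rewrite mulr_suml; apply: eq_bigr => y /hatE ->.
rewrite cst -[X in _ <= X]mulr_sumr.
under [X in _ <= _ * X]eq_bigr do rewrite -[_ ^+ 2]mul1r.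
rewrite (cst (fun=> 1)) [X in _ <= X]mulrA ler_wpM2r ?sqr_ge0 //.
have -> : \sum_(y : 'rV['F_2]_N | wt y == j) (1 : R) = 'C(N, j)%:R.
  by rewrite -card_wt -sum1_card natr_sum; apply: eq_bigl => y; rewrite inE.
apply: le_trans (htyp j _) _; first by rewrite -y0j.
rewrite -mulrA [_ / _]mulrC ler_wpM2r ?mulr_ge0 ?invr_ge0 ?exprn_ge0 //.
by rewrite lerD2l ler_norm.
Qed.

(** * Minimum-weight decoding and collisions *)

Definition collides (N : nat) (C : {vspace 'rV['F_2]_N}) (r : 'rV['F_2]_N) : bool :=
  [exists z : 'rV['F_2]_N, [&& z != r, (wt z <= wt r)%N & r + z \in C]].

(** The default [x] of the [arg min] is admissible because [x + x = 0] lies in the code. *)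
Definition min_weight_decoder (N : nat) (C : {vspace 'rV['F_2]_N}) (x : 'rV['F_2]_N) :
    'rV['F_2]_N :=
  x + [arg min_(z < x | x + z \in C) wt z].

Lemma min_weight_decoder_mem (N : nat) (C : {vspace 'rV['F_2]_N}) (x : 'rV['F_2]_N) :
  min_weight_decoder C x \in C.
Proof.
by rewrite /min_weight_decoder; case: arg_minnP => //; rewrite addrr_F2row mem0v.
Qed.

(** The noise [r] is itself a candidate, so the minimiser [z] is no heavier; if [z] were [r], the
    output would be [c]. The conclusion does not involve [c], so one event covers all codewords. *)
Lemma min_weight_decoder_error (N : nat) (C : {vspace 'rV['F_2]_N}) (c r : 'rV['F_2]_N) :
  c \in C -> min_weight_decoder C (c + r) != c -> collides C r.
Proof.
move=> cC; rewrite /min_weight_decoder.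
case: arg_minnP => [|z zC zmin]; first by rewrite addrr_F2row mem0v.
rewrite -addrA -subr_eq0 [c + _]addrC addrK => rz.
apply/existsP; exists z; apply/and3P; split.
- by apply: contra rz => /eqP ->; rewrite addrr_F2row.
- by apply: zmin; rewrite -addrA addrr_F2row addr0.
- by move: zC; rewrite -addrA rpredDl.
Qed.

(** Each [r] in the ball contributes the diagonal pair [z = r], and a colliding [r] of weight [w] at
    least one pair more. *)
Lemma collision_count (R : realType) (N : nat) (C : {vspace 'rV['F_2]_N}) (w : nat) :
  #|[set r | (wt r == w) && collides C r]%SET|%:R + #|ball N w|%:R <=
  \sum_(r : 'rV['F_2]_N | (wt r <= w)%N)
    \sum_(z : 'rV['F_2]_N | (wt z <= w)%N) (r + z \in C)%:R :> R.
Proof.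
have -> : #|ball N w|%:R = \sum_(r : 'rV['F_2]_N | (wt r <= w)%N) 1 :> R.
  by rewrite -sum1_card natr_sum; apply: eq_bigl => z; rewrite inE.
have -> : #|[set r | (wt r == w) && collides C r]%SET|%:R =
    \sum_(r : 'rV['F_2]_N | (wt r <= w)%N) ((wt r == w) && collides C r)%:R :> R.
  rewrite -sum1_card natr_sum big_mkcond [RHS]big_mkcond; apply: eq_bigr => r _.
  by rewrite inE; case: eqP => [->|]; rewrite ?leqnn /=; case: ifP.
rewrite -big_split; apply: ler_sum => r rw /=.
rewrite (bigD1 r) //= addrr_F2row mem0v addrC lerD2l.
case: eqP => [rE|_] /=; last exact: sumr_ge0.
case: (boolP (collides C r)) => [/existsP[z /and3P[zr zw zC]]|_]; last exact: sumr_ge0.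
rewrite (bigD1 z) /=; last by rewrite -{1}rE zw.
by rewrite zC lerDl sumr_ge0.
Qed.

(** * The noise distribution *)

Lemma noiseE (R : realType) (eps : R) (N : nat) (z : 'rV['F_2]_N) :
  0 < eps < 1 -> noise eps z = expR ((wt z)%:R * ln eps + (N%:R - (wt z)%:R) * ln (1 - eps)).
Proof.
move=> /andP[e0 e1]; have e1' : 0 < 1 - eps by rewrite subr_gt0.
by rewrite expRD -natrB ?wt_le // !expRM_natl !lnK.
Qed.

Lemma noise_ge0 (R : realType) (eps : R) (N : nat) (z : 'rV['F_2]_N) :
  0 < eps < 1 -> 0 <= noise eps z.
Proof. by move=> he; rewrite noiseE // expR_ge0. Qed.

Lemma noise_sum (R : realType) (eps : R) (N : nat) :
  \sum_(z : 'rV['F_2]_N) noise eps z = 1.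
Proof. by rewrite wt_enumerator subrKC expr1n. Qed.

Lemma noise_sum_le1 (R : realType) (eps : R) (N : nat) (P : pred 'rV['F_2]_N) :
  0 < eps < 1 -> \sum_(z | P z) noise eps z <= 1.
Proof.
move=> he; rewrite -(noise_sum eps N) [X in _ <= X](bigID P) /= lerDl.
by apply: sumr_ge0 => z _; exact: noise_ge0.
Qed.

(** The noise is constant on each weight class, so a bound on the fraction of colliding words in
    every class up to [W] is a bound on probability; heavier words are paid for in full. *)
Lemma Pr_collides_le (R : realType) (eps : R) (N : nat) (C : {vspace 'rV['F_2]_N})
    (W gamma : R) :
  0 < eps < 1 -> 0 <= gamma ->
  (forall w : nat, (w <= N)%N -> w%:R <= W ->
     #|[set r | (wt r == w) && collides C r]%SET|%:R <= gamma * 'C(N, w)%:R) ->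
  Pr (@noise R eps N) (collides C) <=
  gamma + Pr (@noise R eps N) (fun r => W < (wt r)%:R).
Proof.
move=> he g0 hw.
rewrite /Pr (bigID (fun r : 'rV_N => (wt r)%:R <= W)) /=; apply: lerD; last first.
  rewrite big_mkcond [X in _ <= X]big_mkcond; apply: ler_sum => r _.
  by rewrite -ltNge; case: (collides C r) => //=; case: ifP => // _; rewrite noise_ge0.
rewrite -[X in _ <= X]mulr1.
apply: le_trans (_ : gamma * \sum_(r : 'rV['F_2]_N | (wt r)%:R <= W) noise eps r <= _); last first.
  by rewrite ler_wpM2l // noise_sum_le1.
rewrite !sum_by_wt mulr_sumr; apply: ler_sum => w _.
have nE (P : pred 'rV['F_2]_N) : \sum_(r | P r && (wt r == w)) noise eps r =
    (eps ^+ w * (1 - eps) ^+ (N - w)) * \sum_(r | P r && (wt r == w)) 1.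
  by rewrite mulr_sumr; apply: eq_bigr => r /andP[_ /eqP]; rewrite /noise => ->; rewrite mulr1.
rewrite !nE mulrCA ler_wpM2l ?mulr_ge0 ?exprn_ge0 //; try by move: he => /andP[? ?]; rewrite ltW // subr_gt0.
have [wW|wW] := leP (w%:R : R) W; last first.
  by rewrite !big1 ?mulr0 // => r; case: eqP => [->|]; rewrite ?andbF // leNgt wW ?andbF.
apply: le_trans (_ : #|[set r | (wt r == w) && collides C r]%SET|%:R <= _).
  rewrite -sum1_card natr_sum big_mkcond [X in _ <= X]big_mkcond; apply: ler_sum => r _.
  by rewrite inE; case: eqP => [_|?]; rewrite ?andbF // ?andbT; case: (collides C r) => //=; case: ifP.
apply: le_trans (hw w _ wW) _; first by rewrite -ltnS.
rewrite -card_wt -sum1_card natr_sum ler_wpM2l //.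
rewrite big_mkcond [X in _ <= X]big_mkcond; apply: ler_sum => r _.
by rewrite inE; case: eqP => [->|?]; rewrite ?andbF ?wW.
Qed.

(** * Binomial, entropy and tail estimates, and the collision bound they give *)

Lemma bin_le_succ (N k : nat) : (k.*2 < N)%N -> ('C(N, k) <= 'C(N, k.+1))%N.
Proof.
move=> kN; have := mul_bin_left N k => e.
rewrite -(leq_pmul2l (ltn0Sn k)) e leq_mul2r; apply/orP; right; lia.
Qed.

Lemma bin_le_half (N k w : nat) : (k <= w)%N -> (w.*2 <= N)%N -> ('C(N, k) <= 'C(N, w))%N.
Proof.
elim: w => [|w IH]; first by rewrite leqn0 => /eqP ->.
rewrite leq_eqVlt => /orP[/eqP -> //|]; rewrite ltnS => kw wN.
apply: leq_trans (IH kw _) (bin_le_succ _); lia.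
Qed.

Lemma card_ball_le (N w : nat) : (w.*2 <= N)%N -> (#|ball N w| <= N.+1 * 'C(N, w))%N.
Proof.
move=> wN.
suff -> : #|ball N w| = (\sum_(k < w.+1) 'C(N, k))%N.
  apply: leq_trans (_ : (\sum_(k < w.+1) 'C(N, w) <= _)%N).
    by apply: leq_sum => k _; apply: bin_le_half => //; rewrite -ltnS.
  by rewrite sum_nat_const card_ord leq_mul2r; apply/orP; right; lia.
rewrite -sum1_card (partition_big (fun z : 'rV['F_2]_N => inord (wt z) : 'I_w.+1) xpredT) //=.
apply: eq_bigr => k _; rewrite -card_wt -sum1_card; apply: eq_bigl => z; rewrite !inE -val_eqE /=.
have [zw|zw] := leqP (wt z) w; first by rewrite inordK.
rewrite /= gtn_eqF //; exact: leq_trans (ltn_ord k) zw.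
Qed.

Lemma entropyE (R : realType) (a : R) : 0 <= a <= 1 ->
  ln 2 * entropy a = - (a * ln a + (1 - a) * ln (1 - a)).
Proof.
move=> /andP[a0 a1].
have l2 : ln 2 != 0 :> R by rewrite gt_eqF // ln_gt0 // ltr1n.
(* At [b = 0] the factor [b] kills both sides, whatever the value of [ln 0]. *)
have aux (b : R) : 0 <= b -> b * log2 (1 / b) = - (b * ln b) / ln 2.
  rewrite le_eqVlt /log2 => /orP[/eqP <-|b0]; first by rewrite !mul0r oppr0 mul0r.
  by rewrite div1r lnV ?posrE // mulrA mulrN.
rewrite /entropy !aux ?subr_ge0 // -mulrDl mulrC divfK //.
by rewrite opprD.
Qed.

(** Each word of weight [i] has probability [2^(- N h(a))] under noise of rate [a = i / N], and
    these probabilities sum to at most 1. The extremes [i = 0] and [i = N] are separate since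
    [noiseE] needs [0 < a < 1]. *)
Lemma bin_le_entropy (R : realType) (N i : nat) : (0 < N)%N -> (i <= N)%N ->
  'C(N, i)%:R <= expR (N%:R * (ln 2 * entropy (i%:R / N%:R))) :> R.
Proof.
move=> N0 iN; have N0' : 0 < N%:R :> R by rewrite ltr0n.
set a : R := i%:R / N%:R.
have aN : a * N%:R = i%:R by rewrite divfK // gt_eqF.
have a0 : 0 <= a by rewrite divr_ge0.
have a1 : a <= 1 by rewrite ler_pdivrMr // mul1r ler_nat.
rewrite entropyE ?a0 //.
have [i0|i0] := posnP i.
  by rewrite /a i0 bin0 mul0r mul0r add0r subr0 ln1 mulr0 oppr0 mulr0 expR0.
have [iN'|iN'] := ltnP i N; last first.
  have -> : i = N by apply/eqP; rewrite eqn_leq iN iN'.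
  have -> : a = 1 by rewrite /a (_ : i = N) ?divff ?gt_eqF //; apply/eqP; rewrite eqn_leq iN iN'.
  by rewrite binn subrr mul0r ln1 mulr0 addr0 oppr0 mulr0 expR0.
have ha : 0 < a < 1.
  by rewrite divr_gt0 ?ltr0n //= ltr_pdivrMr // mul1r ltr_nat.
rewrite mulrN expRN -[X in _ <= X]mul1r ler_pdivlMr ?expR_gt0 //.
apply: le_trans (noise_sum_le1 (fun z : 'rV_N => wt z == i) ha).
rewrite -card_wt -sum1_card natr_sum mulr_suml le_eqVlt; apply/orP; left; apply/eqP.
apply: eq_big => [z|z]; rewrite inE // => /eqP wz.
rewrite noiseE // wz mul1r -aN; congr expR; ring.
Qed.

(** Each of the at most [N + 1] atypical weights satisfies the reversed entropy inequality, which is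
    inserted into [bin_le_entropy]; the leading [N ln 2] cancels against [2 ^+ N]. *)
Lemma atypical_sum_le (R : realType) (eps : R) (N : nat) : (0 < N)%N ->
  (\sum_(i < N.+1 | (i : nat) \notin typical_weights eps N) 'C(N, i)%:R) / 2 ^+ N <=
  N.+1%:R * expR (- (N%:R * (ln 2 * entropy eps)) - ln 2 * (N%:R * N%:R `^ (- (1 / 5)))).
Proof.
move=> N0; have N0' : 0 < N%:R :> R by rewrite ltr0n.
have e2 : 2 ^+ N = expR (N%:R * ln 2) :> R by rewrite expRM_natl lnK ?posrE.
rewrite ler_pdivrMr ?exprn_gt0 // e2 -mulrA -expRD.
set E := expR _.
apply: le_trans (_ : \sum_(i < N.+1) E <= _); last first.
  by rewrite sumr_const card_ord mulr_natl.
rewrite big_mkcond; apply: ler_sum => i _; case: ifP => [iT|_]; last exact: expR_ge0.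
have iN : (i <= N)%N by rewrite -ltnS.
apply: le_trans (bin_le_entropy R N0 iN) _; rewrite ler_expR.
have : entropy (i%:R / N%:R) <= 1 - entropy eps - N%:R `^ (- (1 / 5)) :> R.
  rewrite leNgt; apply: contraNN iT => h; rewrite inE; exists (i%:R / N%:R); split => //.
    by rewrite divr_ge0 //= ler_pdivrMr // mul1r ler_nat.
  by rewrite divfK // gt_eqF.
have l2 : 0 < ln 2 :> R by rewrite ln_gt0 // ltr1n.
move=> /(ler_wpM2l (ltW l2))/(ler_wpM2l (ltW N0')); lra.
Qed.

(** As [eps < 1 / 2], the probability of a word decreases with its weight. Every word of the ball
    thus has probability at least the inverse of the right-hand side, and the total is at most 1. *)
Lemma ball_le_entropy (R : realType) (eps : R) (N w : nat) (D : R) :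
  0 < eps < 1 / 2 -> w%:R <= eps * N%:R + D ->
  #|ball N w|%:R <= expR (N%:R * (ln 2 * entropy eps) + D * (ln (1 - eps) - ln eps)).
Proof.
move=> he hw; have [e0 e1] : 0 < eps /\ eps < 1 by split; lra.
have he1 : 0 < eps < 1 by rewrite e0.
rewrite -[X in _ <= X]invrK -expRN -[X in _ <= X]mul1r ler_pdivlMr ?expR_gt0 //.
apply: le_trans (noise_sum_le1 (fun z : 'rV_N => (wt z <= w)%N) he1).
rewrite -sum1_card natr_sum mulr_suml.
rewrite [X in X <= _](eq_bigl (fun z : 'rV_N => (wt z <= w)%N)) => [|z]; last by rewrite inE.
apply: ler_sum => z zw; rewrite noiseE // mul1r ler_expR entropyE; last by rewrite !ltW.
have A0 : 0 <= ln (1 - eps) - ln eps by rewrite subr_ge0 ler_ln ?posrE; lra.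
have : (wt z)%:R <= eps * N%:R + D by apply: le_trans hw; rewrite ler_nat.
move=> /(ler_wpM2r A0); lra.
Qed.

(** Chernoff: the indicator of the tail is at most [expR (t * ((wt r)%:R - W))], whose mean
    [wt_enumerator] evaluates. *)
Lemma tail_le (R : realType) (eps : R) (N : nat) (D t : R) :
  0 < eps < 1 -> 0 <= t <= 1 / 2 ->
  Pr (@noise R eps N) (fun r => eps * N%:R + D < (wt r)%:R) <=
  expR (2 * eps * (N%:R * t ^+ 2) - t * D).
Proof.
move=> he ht; have [e0 e1] : 0 < eps /\ eps < 1 by apply/andP.
set W := eps * N%:R + D.
apply: le_trans (_ : expR (- (t * W)) * (eps * expR t + (1 - eps)) ^+ N <= _).
  rewrite -wt_enumerator mulr_sumr /Pr big_mkcond; apply: ler_sum => z _.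
  have noise' : expR (- (t * W)) * ((eps * expR t) ^+ wt z * (1 - eps) ^+ (N - wt z)) =
      expR (t * ((wt z)%:R - W)) * noise eps z.
    rewrite exprMn mulrBr expRD /noise [t * (wt z)%:R]mulrC expRM_natl; ring.
  rewrite noise'; case: ifP => [zW|_]; last by rewrite mulr_ge0 ?expR_ge0 ?noise_ge0.
  rewrite ler_peMl ?noise_ge0 // -[X in X <= _](expR0) ler_expR mulr_ge0 //; first by case/andP: ht.
  by rewrite subr_ge0 ltW.
(* Goes through [expR t <= 1 / (1 - t)]; then [(1 + t + 2 t^2)(1 - t) = 1 + t^2 (1 - 2 t)] is at
   least 1 because [t <= 1 / 2]. *)
have et : expR t <= 1 + t + 2 * t ^+ 2.
  have := expR_ge1Dx (- t); rewrite expRN => h.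
  have t1 : 0 < 1 - t by lra.
  have : expR t <= (1 - t)^-1 by rewrite -[X in X <= _]invrK lef_pV2 ?posrE ?invr_gt0 ?expR_gt0.
  move=> /le_trans; apply.
  rewrite -[X in X <= _]mul1r ler_pdivrMr //; nra.
apply: le_trans (_ : expR (- (t * W)) * expR (eps * (t + 2 * t ^+ 2)) ^+ N <= _).
  rewrite ler_wpM2l ?expR_ge0 // lerXn2r ?nnegrE ?expR_ge0 //.
    by rewrite addr_ge0 ?mulr_ge0 ?expR_ge0 ?subr_ge0 ?ltW.
  apply: le_trans (expR_ge1Dx _); nra.
rewrite -expRM_natl -expRD ler_expR /W; lra.
Qed.

(* With u = N^(1/60), the exponents 2/3, 3/4 and 4/5 of N become 40, 45 and 48. *)
Lemma collision_probability_le (R : realType) (eps : R) (N : nat)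
    (C : {vspace 'rV['F_2]_N}) (delta : R) :
  0 < eps < 1 / 2 -> (0 < N)%N ->
  (forall j : nat, j \in typical_weights eps N ->
     Pr (uniform R (dual C)) (fun y => wt y == j) <= (1 + delta) * ('C(N, j)%:R / 2 ^+ N)) ->
  Pr (uniform R (dual C)) (fun y => wt y \notin typical_weights eps N) <=
    2 `^ (N%:R `^ (3 / 4)) *
      ((\sum_(i < N.+1 | (i : nat) \notin typical_weights eps N) 'C(N, i)%:R) / 2 ^+ N) ->
  let u : R := N%:R `^ (1 / 60) in
  2 <= u -> 1 <= (1 / 2 - eps) * u ->
  Pr (@noise R eps N) (collides C) <=
  N.+1%:R * (`|delta| + N.+1%:R *
    expR (ln 2 * (u ^+ 45 - u ^+ 48) + u ^+ 40 * (ln (1 - eps) - ln eps))) +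
  expR (2 * eps - u ^+ 10).
Proof.
move=> he N0 htyp hatyp u u2 ueps.
have N0' : 0 < N%:R :> R by rewrite ltr0n.
have uX k : u ^+ k = N%:R `^ (k%:R / 60).
  by rewrite -powR_mulrn ?powR_ge0 // -powRrM; congr (_ `^ _); field.
have u60 : u ^+ 60 = N%:R by rewrite uX divff // powRr1.
have u45 : N%:R `^ (3 / 4) = u ^+ 45 by rewrite uX; congr (_ `^ _); field.
have u48 : N%:R * N%:R `^ (- (1 / 5)) = u ^+ 48.
  rewrite uX -{1}[N%:R]powRr1 // -powRD; last by apply/implyP => _; rewrite gt_eqF.
  by congr (_ `^ _); field.
have he1 : 0 < eps < 1 by apply/andP; split; lra.
have u0 : 0 < u by apply: lt_le_trans u2.
pose E := expR (ln 2 * (u ^+ 45 - u ^+ 48) + u ^+ 40 * (ln (1 - eps) - ln eps)).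
set D := u ^+ 40; set A := ln (1 - eps) - ln eps.
apply: le_trans (_ : _ + Pr (@noise R eps N) (fun r => eps * N%:R + D < (wt r)%:R) <= _).
  apply: (@Pr_collides_le _ _ _ _ _ (N.+1%:R * (`|delta| + N.+1%:R * E))) => //.
    by rewrite mulr_ge0 // addr_ge0 // mulr_ge0 // expR_ge0.
  move=> w wN wW.
  have wN2 : (w.*2 <= N)%N.
    rewrite -(ler_nat R) -muln2 natrM.
    (* Multiply [1 <= (1 / 2 - eps) * u] by [u ^+ 59], using [u ^+ 60 = N]. *)
    have : D <= (1 / 2 - eps) * N%:R.
      have := ler_wpM2r (exprn_ge0 59 (ltW u0)) ueps; rewrite -mulrA -exprS u60 => h.
      have u1 : 1 <= u by lra.
      apply: le_trans h; rewrite mul1r /D.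
      exact: ler_weXn2l.
    lra.
  set b : R := #|ball N w|%:R.
  have bN : b <= N.+1%:R * 'C(N, w)%:R by rewrite -natrM ler_nat card_ball_le.
  set zeta := _ * _ in hatyp.
  (* The factor [2^(N h(eps))] of the ball bound cancels its inverse in the atypical bound. The gap
     [u ^+ 45 - u ^+ 48] and the cost of the excess radius [D] remain. *)
  have bz : b * zeta <= N.+1%:R * E.
    apply: le_trans (_ : expR (N%:R * (ln 2 * entropy eps) + D * A) *
      (expR (u ^+ 45 * ln 2) * (N.+1%:R * expR (- (N%:R * (ln 2 * entropy eps)) - ln 2 * u ^+ 48))) <= _).
      rewrite ler_pM //.
      - by rewrite mulr_ge0 ?powR_ge0 // divr_ge0 ?exprn_ge0 ?sumr_ge0.
      - exact: ball_le_entropy.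
      - by rewrite /zeta u45 {1}/powR pnatr_eq0 /= ler_wpM2l ?expR_ge0 // -u48 atypical_sum_le.
    rewrite !mulrA [_ * N.+1%:R]mulrC -!mulrA ler_wpM2l // -!expRD ler_expR /D /A; lra.
  (* The diagonal term [b] on the left cancels the main term on the right. *)
  have := le_trans (collision_count R C w) (ball_pairs_le w htyp hatyp).
  rewrite -/b => h.
  apply: le_trans (_ : b * (`|delta| + b * zeta) <= _); first by lra.
  rewrite mulrAC; apply: ler_pM; rewrite ?lerD2l //.
  by rewrite addr_ge0 // mulr_ge0 // mulr_ge0 ?powR_ge0 // divr_ge0 ?exprn_ge0 ?sumr_ge0.

rewrite lerD2l.
(* The Chernoff parameter is [t = u ^- 30], that is [N^(-1/2)]: then [N t^2 = 1] and
   [t D = u ^+ 10]. *)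
have -> : expR (2 * eps - u ^+ 10) = expR (2 * eps * (N%:R * (u ^- 30) ^+ 2) - u ^- 30 * D).
  congr expR; rewrite -u60 /D; field; lra.
apply: tail_le => //; rewrite invr_ge0 exprn_ge0 ?(ltW u0) //=.
rewrite div1r lef_pV2 ?posrE ?exprn_gt0 //.
by apply: (le_trans u2); rewrite -[X in X <= _]expr1; apply: ler_weXn2l => //; lra.
Qed.

(** * Asymptotics as the length grows *)

(** Multiplying the last hypothesis by [u ^+ 45] bounds [(123 + A + L) u^45] by [L u^46], hence by
    [L u^48]. Here 123 is the sum of 2 and 120 from [2 * (1 + 60 * u)] and 1 from the target
    [- u]. *)
Lemma exponents_le (R : realType) (L A eps u : R) : 0 < L -> 0 <= A -> 0 < eps < 1 / 2 ->
  2 <= u -> 123 + A + L <= L * u ->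
  2 * (1 + 60 * u) + (L * (u ^+ 45 - u ^+ 48) + u ^+ 40 * A) <= - u /\
  2 * eps - u ^+ 10 <= 1 - u.
Proof.
move=> L0 A0 he u2 uL; have u1 : 1 <= u by lra.
have u_le k : u <= u ^+ k.+1 by rewrite -[X in X <= _]expr1; apply: ler_weXn2l.
split; last by have := u_le 9; lra.
have h40 : u ^+ 40 * A <= u ^+ 45 * A by rewrite ler_wpM2r //; exact: ler_weXn2l.
have h46 : L * u ^+ 46 <= L * u ^+ 48.
  by apply: ler_wpM2l; [exact: ltW|exact: ler_weXn2l].
have u45 := u_le 44.
have p45 : 0 <= u ^+ 45 by lra.
have := ler_wpM2r p45 uL; rewrite -mulrA -exprS => h.
lra.
Qed.

Lemma collision_probability_le_expR (R : realType) (eps : R) (N : nat)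
    (C : {vspace 'rV['F_2]_N}) (delta : R) :
  0 < eps < 1 / 2 -> (0 < N)%N ->
  (forall j : nat, j \in typical_weights eps N ->
     Pr (uniform R (dual C)) (fun y => wt y == j) <= (1 + delta) * ('C(N, j)%:R / 2 ^+ N)) ->
  Pr (uniform R (dual C)) (fun y => wt y \notin typical_weights eps N) <=
    2 `^ (N%:R `^ (3 / 4)) *
      ((\sum_(i < N.+1 | (i : nat) \notin typical_weights eps N) 'C(N, i)%:R) / 2 ^+ N) ->
  let u : R := N%:R `^ (1 / 60) in
  2 <= u -> 1 <= (1 / 2 - eps) * u ->
  123 + (ln (1 - eps) - ln eps) + ln 2 <= ln 2 * u ->
  Pr (@noise R eps N) (collides C) <=
  N.+1%:R * `|delta| + expR (- u) + expR 1 * expR (- u).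
Proof.
move=> he N0 htyp hatyp u u2 ueps uL.
have L0 : 0 < ln 2 :> R by rewrite ln_gt0 // ltr1n.
have A0 : 0 <= ln (1 - eps) - ln eps by rewrite subr_ge0 ler_ln ?posrE; lra.
have [h1 h2] := exponents_le L0 A0 he u2 uL.
apply: le_trans (collision_probability_le he N0 htyp hatyp u2 ueps) _.
rewrite -/u mulrDr -expRD; apply: lerD; last by rewrite ler_expR.
rewrite lerD2l mulrA.
have u60 : u ^+ 60 = N%:R.
  by rewrite -powR_mulrn ?powR_ge0 // -powRrM div1r mulVf // powRr1.
(* From [u <= expR u] one gets [N = u ^+ 60 <= expR (60 * u)]; the added 1 costs a factor 2, which
   is at most [expR 1]. *)
have N1 : N.+1%:R <= expR (1 + 60 * u) :> R.
  rewrite -natr1 -u60 expRD expRM_natl.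
  have := expR_ge1Dx (1 : R); have := expR_ge1Dx u => hu he'.
  have p60 : u ^+ 60 <= expR u ^+ 60 by rewrite lerXn2r ?nnegrE ?expR_ge0 //; lra.
  have p1 : 1 <= expR u ^+ 60 by rewrite exprn_ege1 //; lra.
  have : 2 * expR u ^+ 60 <= expR 1 * expR u ^+ 60 by rewrite ler_wpM2r //; lra.
  lra.
set F := (X in _ * X <= _).
apply: le_trans (_ : expR (1 + 60 * u) * expR (1 + 60 * u) * F <= _).
  by rewrite ler_wpM2r ?expR_ge0 // ler_pM.
by rewrite -!expRD ler_expR; lra.
Qed.

Lemma cvg_powR_natr_pinfty (R : realType) (p : R) : 0 < p ->
  (N%:R `^ p : R) @[N --> \oo] --> +oo.
Proof.
move=> p0; apply/cvgryPge => A.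
apply: filterS (nbhs_infty_ger (`|A| `^ p^-1)) => N /= hN.
apply: le_trans (ler_norm A) _.
have -> : `|A| = (`|A| `^ p^-1) `^ p by rewrite -powRrM mulVf ?gt_eqF // powRr1.
by rewrite ge0_ler_powR ?nnegrE ?powR_ge0 // ltW.
Qed.

Theorem corollary1p3 (R : realType) (eps : R) (heps : 0 < eps < 1 / 2)
    (S : set nat) (hS : infinite_set S)
    (C : forall N : nat, {vspace 'rV['F_2]_N})
    (htypical : exists delta : nat -> R,
       delta =o_ (within S \oo) (fun N : nat => N%:R^-1 : R) /\
       forall N : nat, S N -> forall j : nat, j \in typical_weights eps N ->
         Pr (uniform R (dual (C N))) (fun y => wt y == j)
           <= (1 + delta N) * ('C(N, j)%:R / 2 ^+ N))
    (hatypical : forall N : nat, S N ->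
       Pr (uniform R (dual (C N))) (fun y => wt y \notin typical_weights eps N)
         <= 2 `^ (N%:R `^ (3 / 4)) *
            ((\sum_(i < N.+1 | (i : nat) \notin typical_weights eps N)
                'C(N, i)%:R) / 2 ^+ N)) :
  resilient eps S C.
Proof.
have [delta [hdelta htyp]] := htypical.
exists (fun N => @min_weight_decoder N (C N)); split=> [N _ x|c hc].
  exact: min_weight_decoder_mem.
pose u N : R := N%:R `^ (1 / 60).
have uoo : u N @[N --> within S \oo] --> +oo.
  apply: cvg_trans (cvg_powR_natr_pinfty (_ : 0 < 1 / 60 :> R)); last by lra.
  by apply: cvg_app; exact: cvg_within.
have expu0 : expR (- u N) @[N --> within S \oo] --> (0 : R).
  exact: (cvg_comp u _ uoo (@cvgr_expR R)).
(* The little-o hypothesis is used at tolerance [e / 2], because [N + 1 <= 2 N] for positive [N]. *)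
have Ndelta0 : N.+1%:R * `|delta N| @[N --> within S \oo] --> (0 : R).
  apply/cvgr0Pnorm_le => e e0.
  have e20 : 0 < e / 2 by lra.
  have hN : \forall N \near within S \oo, `|delta N| <= e / 2 * `|N%:R^-1 : R|.
    exact: ((eqoP _ _ _).1 hdelta _ e20).
  have h0 : \forall N \near within S \oo, (0 < N)%N.
    by apply: cvg_within; exact: nbhs_infty_gt.
  near=> N.
  have N0 : (0 < N)%N by near: N.
  have N0' : 0 < N%:R :> R by rewrite ltr0n.
  have N1 : N.+1%:R <= 2 * N%:R :> R by rewrite -natrM ler_nat; lia.
  have : `|delta N| <= e / 2 * `|N%:R^-1 : R| by near: N.
  rewrite normrM !normr_id normr_nat (ger0_norm (_ : 0 <= N%:R^-1)) ?invr_ge0 // => hd.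
  apply: le_trans (ler_pM _ _ N1 hd) _ => //.
  by rewrite mulrACA mulfV ?gt_eqF // mulr1 mulrC divfK.
(* The explicit bound holds as soon as [u N] passes finitely many thresholds depending only on
   [eps]. *)
apply: (squeeze_cvgr (f := fun=> 0) (h := fun N => N.+1%:R * `|delta N| + expR (- u N) + expR 1 * expR (- u N))).
- have u_ge a : \forall N \near within S \oo, a <= u N by exact: (cvgryPge u).1.
  near=> N.
  have SN : S N by near: N; exact: withinT.
  have N0 : (0 < N)%N by near: N; apply: cvg_within; exact: nbhs_infty_gt.
  have L0 : 0 < ln 2 :> R by rewrite ln_gt0 // ltr1n.
  have he1 : 0 < eps < 1 by apply/andP; split; lra.
  have u2 : 2 <= u N by near: N; exact: u_ge.
  have ueps : 1 <= (1 / 2 - eps) * u N.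
    rewrite mulrC -ler_pdivrMr; last by lra.
    by near: N; exact: u_ge.
  have uL : 123 + (ln (1 - eps) - ln eps) + ln 2 <= ln 2 * u N.
    rewrite [X in _ <= X]mulrC -ler_pdivrMr //.
    by near: N; exact: u_ge.
  apply/andP; split; first by apply: sumr_ge0 => r _; exact: noise_ge0.
  apply: le_trans (collision_probability_le_expR heps N0 (htyp N SN) (hatypical N SN) u2 ueps uL).
  (* A decoding error forces a collision, so the error sum is dominated term by term. *)
  rewrite /Pr big_mkcond [X in _ <= X]big_mkcond; apply: ler_sum => r _.
  case: ifP => [/(min_weight_decoder_error (hc N SN)) ->//|_].
  by case: ifP => // _; exact: noise_ge0.
- exact: cvg_cst.
- rewrite -[X in _ --> X]addr0 -[X in _ --> _ + X](mulr0 (expR 1)).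
  apply: cvgD; last exact: cvgMr.
  by rewrite -[X in _ --> X]addr0; apply: cvgD.
Unshelve. all: end_near.
Qed.
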